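(* Let $R=\{0=r_0,r_1,\dots,r_n,\rightarrow\}$ be an almost symmetric numerical semigroup of type $t\geq 2$ with $R\neq\{0,t+1,\rightarrow\}$, and let $\mathrm{PF}(R)=\{a_1<a_2<\dots<a_t=\mathrm{F}(R)\}$ be its set of pseudo-Frobenius numbers. Suppose that, for some $k\in\{1,\dots,n\}$, $r_{k-1}<a_1<\dots<a_{t-1}<r_k$, where $a_i-a_{i-1}=1$ for $i=2,\dots,t-1$. Then there is a unique proper numerical set $S$ such that $$R=S\boxplus_{C}\{0,t+1,\rightarrow\}\boxplus_{B}S^{*}\quad\text{or}\quad R=S\boxplus_{B}\{0,t+1,\rightarrow\}\boxplus_{C}S^{*}.$$
   Context: Write $\mathbb{N}_0=\{0,1,2,\dots\}$. A numerical set is a subset $R\subseteq\mathbb{N}_0$ containing $0$ with finite complement in $\mathbb{N}_0$; it is proper if $R\neq\mathbb{N}_0$, and it is a numerical semigroup if it is closed under addition. For proper $R$, $\mathrm{G}(R)=\mathbb{N}_0\setminus R$ is the set of gaps, $\mathrm{g}(R)=|\mathrm{G}(R)|$ the genus, $\mathrm{F}(R)=\max \mathrm{G}(R)$ the Frobenius number, and $\mathrm{C}(R)=\mathrm{F}(R)+1$ the conductor. The notation $R=\{0=r_0,r_1,\dots,r_n,\rightarrow\}$ means that $0=r_0<r_1<\dots<r_{n-1}<r_n=\mathrm{C}(R)$ are all the elements of $R$ that are $\le\mathrm{C}(R)$, and that all integers greater than $\mathrm{C}(R)$ also belong to $R$. Thus for $m\ge 2$, $\{0,m,\rightarrow\}=\{0\}\cup\{x\in\mathbb{N}_0: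 x\ge m\}$. For a numerical semigroup $R$, an integer $z\in\mathbb{Z}$ is a pseudo-Frobenius number if $z\notin R$ and $z+r\in R$ for all nonzero $r\in R$; $\mathrm{PF}(R)$ is the set of these, and the type is $\mathrm{t}(R)=|\mathrm{PF}(R)|$. $R$ is almost symmetric if $2\mathrm{g}(R)=\mathrm{F}(R)+\mathrm{t}(R)$. The dual of a proper numerical set $S$ is the numerical set $S^{*}=\{\mathrm{F}(S)-a : a\in \mathrm{G}(S)\}\cup\{x\in\mathbb{N}_0: x\ge \mathrm{C}(S)\}$ (with $\mathrm{C}(S^* )=\mathrm{C}(S)$). For proper numerical sets $R=\{0,r_1,\dots,r_n=\mathrm{C}(R),\rightarrow\}$ and $S=\{0,s_1,\dots,s_m=\mathrm{C}(S),\rightarrow\}$ define the bonded sum $R\boxplus_{B}S=\{0,r_1,\dots,r_{n-1},r_n-1,s_1+r_n-1,\dots,s_m+r_n-1,\rightarrow\}$ and the conjoint sum $R\boxplus_{C}S=\{0,r_1,\dots,r_{n-1},s_1+r_n-1,\dots,s_m+r_n-1,\rightarrow\}$. Expressions with several of these operations are evaluated from left to right. *)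

(* Defs.v *)
From mathcomp Require Import all_boot all_order all_algebra.
From mathcomp Require Import finmap.
From mathcomp Require Import boolp classical_sets functions cardinality.

Set Implicit Arguments.
Unset Strict Implicit.
Unset Printing Implicit Defensive.

Local Open Scope classical_set_scope.

Definition numerical_set (R : set nat) : Prop :=
  R 0 /\ finite_set (~` R).

Definition proper_numerical_set (R : set nat) : Prop :=
  numerical_set R /\ R <> setT.

Definition numerical_semigroup (R : set nat) : Prop :=
  numerical_set R /\ forall x y, R x -> R y -> R (x + y).

Definition gaps (R : set nat) : set nat := ~` R.

(* [fset_set] yields the underlying finite set of a finite set, and the empty
   set on infinite ones; [genus], [Frobenius] and [conductor] are thus
   meaningful only for proper numerical sets. *)
Definition genus (R : set nat) : nat := #|` fset_set (gaps R) |.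

Definition Frobenius (R : set nat) : nat := \max_(x <- fset_set (gaps R)) x.

Definition conductor (R : set nat) : nat := (Frobenius R).+1.

(* R = {0 = r 0, r 1, ..., r n, ->}, where r n is the conductor; the values of
   r beyond n are irrelevant. *)
Definition enumerated_by (R : set nat) (n : nat) (r : nat -> nat) : Prop :=
  [/\ proper_numerical_set R,
      r 0 = 0,
      forall i j, i < j <= n -> r i < r j,
      r n = conductor R
    & forall x, x <= conductor R -> R x <-> exists2 i, i <= n & x = r i].

(* [Posz @` R] is R seen as a set of integers. *)
Definition pseudo_Frobenius (R : set nat) : set int :=
  [set z : int | ~ (Posz @` R) z /\
     forall r : nat, R r -> r <> 0 -> (Posz @` R) (z + r%:Z)%R].

Definition sgtype (R : set nat) : nat := #|` fset_set (pseudo_Frobenius R) |.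

Definition almost_symmetric (R : set nat) : Prop :=
  2 * genus R = Frobenius R + sgtype R.

(* {0, m, ->} *)
Definition ordinary (m : nat) : set nat := [set x | x = 0 \/ m <= x].

(* The truncated subtraction is exact here since gaps are at most F(S). *)
Definition dual (S : set nat) : set nat :=
  [set Frobenius S - a | a in gaps S] `|` [set x | conductor S <= x].

(* With r_n = C(R), the part {0, r_1, ..., r_(n-1)} consists of the elements of
   R below C(R), and r_n - 1 = F(R). Translating all of S (resp. all of S but 0)
   by r_n - 1 yields s_j + r_n - 1 for 0 <= j (resp. 1 <= j), together with all
   the integers that follow. *)
Definition bonded_sum (R S : set nat) : set nat :=
  [set x | R x /\ x < conductor R] `|`
  [set s + (conductor R - 1) | s in S].

Definition conjoint_sum (R S : set nat) : set nat :=
  [set x | R x /\ x < conductor R] `|`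
  [set s + (conductor R - 1) | s in S `\ 0].

Notation "R ⊞B S" := (bonded_sum R S) (at level 50, left associativity).
Notation "R ⊞C S" := (conjoint_sum R S) (at level 50, left associativity).

(* Main.v *)
Require Import Defs.
From mathcomp Require Import all_boot all_order all_algebra.
From mathcomp Require Import boolp classical_sets.
From mathcomp Require Import finmap cardinality zify.

(** Reflect R in its Frobenius number F. Since F is a gap and R is closed under
addition, at least one of x and F - x is a gap for every 0 <= x <= F, and 2 g(R)
exceeds F + 1 by the number of gaps x for which F - x is a gap as well
([card_mirror_gaps]). Every pseudo-Frobenius number other than F is such a gap,
because adding F - x to x must not give F ([pseudo_Frobenius_sub_mirror_gaps]).
Almost symmetry says that the two counts agree, so PF(R) consists exactly of F
and the gaps x whose mirror image is a gap
([almost_symmetric_pseudo_Frobenius]).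

As a_1, ..., a_(t-1) are consecutive, they fill an interval, which the
reflection maps to itself. With f = a_1 - 1 the interval is f+1, ..., f+t-1 and
F = 2f + t. Outside this interval, x is in R if and only if F - x is not: thus R
is determined by its part below f and by which one of f and f + t it contains.

On the other side, if S has Frobenius number f, then the two composite sums are
equal to S below f, have no element strictly between f and f + t, are the
complemented mirror image of S above f + t, and contain exactly one of f and
f + t: the conjoint sum omits f, the bonded sum keeps it
([conjoint_bonded_dualE], [bonded_conjoint_dualE]). So R has one of the two
forms when S is R below f together with all integers above f
([truncation_decomposition]). It is the only choice: both sums have Frobenius
number 2 F(S) + t, which forces F(S) = f, and below f they are equal to S
([decomposition_truncation]). The excluded semigroup {0, t+1, ->} is the case
f = 0, in which such an S would not contain 0. *)

Local Open Scope classical_set_scope.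

(** * Frobenius numbers *)

(** Turns cardinals into sums of indicators, on which reflecting the interval is
a mere reindexing. *)
Lemma card_fset_set_below {D : set nat} {m : nat} :
  (forall x, D x -> x < m) ->
  #|` fset_set D| = \sum_(i < m) `[< D i >].
Proof.
move=> D_lt.
have -> : fset_set D = [fset x in [seq x <- iota 0 m | `[< D x >]]]%fset.
  have finD : finite_set D.
    by apply: (sub_finite_set _ (finite_II m)) => x /= /D_lt.
  apply/fsetP => x; rewrite in_fset_set // inE /= mem_filter mem_iota add0n /=.
  apply/idP/idP => [/set_mem Dx|/andP[/asboolP Dx _]]; last exact/mem_set.
  by rewrite D_lt // andbT; apply/asboolP.
rewrite card_fseq undup_id ?filter_uniq ?iota_uniq // size_filter.
have -> : iota 0 m = index_iota 0 m by rewrite /index_iota subn0.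
by rewrite -sum1_count big_mkcond /= big_mkord; apply: eq_bigr => i _; case: ifP.
Qed.

Lemma Frobenius_unique {R : set nat} {f : nat} :
  ~ R f -> (forall x, f < x -> R x) -> Frobenius R = f.
Proof.
move=> Rf R_gt.
have gap_le x : ~ R x -> x <= f by move=> Rx; rewrite leqNgt; apply/negP => /R_gt.
have fin : finite_set (gaps R).
  by apply: (sub_finite_set _ (finite_II f.+1)) => x /= /gap_le.
apply/eqP; rewrite eqn_leq; apply/andP; split.
  by apply/bigmax_leqP_seq => x; rewrite in_fset_set // => /set_mem /gap_le.
by apply: leq_bigmax_seq => //; rewrite in_fset_set //; apply/mem_set.
Qed.

Lemma Frobenius_spec {R : set nat} :
  proper_numerical_set R ->
  ~ R (Frobenius R) /\ forall x, Frobenius R < x -> R x.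
Proof.
move=> [[_ fin] RT].
have R_gt x : Frobenius R < x -> R x.
  rewrite ltnNge => /negP le_x; apply: contrapT => Rx; apply: le_x.
  by apply: leq_bigmax_seq => //; rewrite in_fset_set //; apply/mem_set.
split=> //.
have [x0 Rx0] : exists x, ~ R x.
  by apply/existsNP => RA; apply: RT; apply/seteqP; split.
have [x Rx max_x] : exists2 x, ~ R x & forall y, ~ R y -> y <= x.
  have ex : exists x, `[< ~ R x >] by exists x0; apply/asboolP.
  have ub x : `[< ~ R x >] -> x <= Frobenius R.
    move=> /asboolP Rx; rewrite leqNgt; apply/negP => lt_x; exact: Rx (R_gt _ lt_x).
  case: (ex_maxnP ex ub) => x /asboolP Rx max_x; exists x => // y Ry.
  by apply: max_x; apply/asboolP.
rewrite (@Frobenius_unique _ x) // => y lt_xy; apply: contrapT => /max_x; lia.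
Qed.

(** * Reflection in the Frobenius number *)

(** The gaps whose mirror image F(R) - x is a gap too, together with F(R), whose
mirror image 0 is never a gap: this is the form that PF(R) takes in the almost
symmetric case. *)
Definition mirror_gaps (R : set nat) : set nat :=
  [set x | [/\ ~ R x, x <= Frobenius R & x <> Frobenius R -> ~ R (Frobenius R - x)]].

Lemma mirror_complement {R : set nat} {x : nat} :
  proper_numerical_set R -> numerical_semigroup R ->
  x <= Frobenius R -> ~ mirror_gaps R x ->
  R x <-> ~ R (Frobenius R - x).
Proof.
move=> pR [_ R_add] le_x nmx; have [RF _] := Frobenius_spec pR.
split=> [Rx RFx|RFx]; first by apply: RF; have := R_add _ _ Rx RFx; rewrite subnKC.
by apply: contrapT => Rx; apply: nmx; split.
Qed.

(** If z is pseudo-Frobenius, then z + r = F(R) is impossible for nonzero r in R.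
The choice r = F(R) - z rules out both a negative z (then r > F(R)) and a z whose
mirror image belongs to R. *)
Lemma pseudo_Frobenius_sub_mirror_gaps {R : set nat} :
  proper_numerical_set R ->
  pseudo_Frobenius R `<=` Posz @` mirror_gaps R.
Proof.
move=> pR; have [RF R_gt] := Frobenius_spec pR.
have addF (z : int) (r : nat) : pseudo_Frobenius R z -> R r -> r <> 0 ->
    (z + r%:Z <> (Frobenius R)%:Z)%R.
  by move=> [_ PFz] Rr r0 zr; have [y Ry] := PFz r Rr r0; rewrite zr => -[yF];
    apply: RF; rewrite -yF.
move=> z PFz.
have z_ge0 : (0 <= z)%R.
  case: (boolP (0 <= z)%R) => // z_lt0; exfalso.
  apply: (addF z (Frobenius R + `|z|)%N PFz); [apply: R_gt| |]; lia.
have [Rz _] := PFz.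
have zE : Posz `|z|%N = z by lia.
exists `|z|%N => //.
have Rx : ~ R `|z|%N by move=> Rz'; apply: Rz; exists `|z|%N.
have le_x : `|z|%N <= Frobenius R by rewrite leqNgt; apply/negP => /R_gt.
by split=> // xF RFx; apply: (addF z _ PFz RFx); lia.
Qed.

(** For x < F(R) the gaps among x and F(R) - x number two if x is a mirror gap and
one otherwise; summing over x counts every gap twice. *)
Lemma card_mirror_gaps {R : set nat} :
  proper_numerical_set R -> numerical_semigroup R ->
  2 * genus R = Frobenius R + #|` fset_set (mirror_gaps R)|.
Proof.
move=> pR sR; have [[[R0 _] _] [RF R_gt]] := (sR, Frobenius_spec pR).
set F := Frobenius R in RF R_gt *.
have -> : genus R = \sum_(i < F.+1) `[< ~ R i >].
  apply: card_fset_set_below => x Rx; rewrite ltnS leqNgt; apply/negP => /R_gt.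
  exact: Rx.
rewrite (@card_fset_set_below _ F.+1); last by move=> x [].
rewrite mul2n -addnn {2}(reindex_inj rev_ord_inj) /= -big_split /=.
(* The term F is separate: it is a mirror gap by convention, and 0 is no gap. *)
rewrite big_ord_recr [in RHS]big_ord_recr /= subnn [in RHS]addnA.
congr (_ + _).
  have sumF : \sum_(i < F) 1 = F by rewrite sum1_card card_ord.
  rewrite -[X in _ = X + _]sumF -big_split /=.
  apply: eq_bigr => i _; have lt_iF := ltn_ord i; rewrite subSS.
  case: (asboolP (mirror_gaps R i)) => [[Ri _ RFi]|nmi].
    have {}RFi : ~ R (F - i) by apply: RFi; rewrite -/F; lia.
    by rewrite !asboolT.
  have := mirror_complement pR sR (ltnW lt_iF) nmi; rewrite -/F.
  by case: asboolP; case: asboolP; tauto.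
have mF : mirror_gaps R F by split.
by rewrite (asboolT RF) (asboolT mF) asboolF // => /(_ R0).
Qed.

(** Almost symmetry is the equality case of the inclusion of PF(R) in the mirror
gaps, once both are counted. *)
Lemma almost_symmetric_pseudo_Frobenius {R : set nat} :
  proper_numerical_set R -> numerical_semigroup R -> almost_symmetric R ->
  pseudo_Frobenius R = Posz @` mirror_gaps R.
Proof.
move=> pR sR; rewrite /almost_symmetric card_mirror_gaps // => /eqP.
rewrite eqn_add2l /sgtype => /eqP cardE.
have sub := pseudo_Frobenius_sub_mirror_gaps pR.
have finM : finite_set (mirror_gaps R).
  apply: (sub_finite_set _ (finite_II (Frobenius R).+1)) => x /= [_ le_x _].
  by rewrite ltnS.
have finPM := finite_image Posz finM.
have finP := sub_finite_set sub finPM.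
have cardPM : #|` fset_set (Posz @` mirror_gaps R)| = #|` fset_set (mirror_gaps R)|.
  by rewrite fset_set_image // card_imfset //= => x y [].
apply/fset_set_inj => //; apply/eqP.
rewrite eqEfcard cardPM cardE leqnn andbT.
by rewrite -fset_set_sub.
Qed.

(** * Membership in the sums *)

Lemma dualE {S : set nat} :
  proper_numerical_set S ->
  forall x, dual S x <-> (x <= Frobenius S -> ~ S (Frobenius S - x)).
Proof.
move=> pS x; set f := Frobenius S.
have [Sf S_gt] := Frobenius_spec pS; rewrite /dual /conductor /= -/f.
split=> [[[a Sa <-] _|lt_fx le_xf]|Sx]; last 2 first.
- lia.
- case: (leqP x f) => le_xf; [left|by right].
  by exists (f - x); [exact: Sx | rewrite subKn].
- have le_af : a <= f by rewrite leqNgt; apply/negP => /S_gt.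
  by rewrite subKn.
Qed.

Lemma bonded_sumE {A B : set nat} {f : nat} :
  Frobenius A = f -> ~ A f ->
  forall x, (A ⊞B B) x <-> x < f /\ A x \/ f <= x /\ B (x - f).
Proof.
move=> fA Af x; rewrite /bonded_sum /conductor subn1 /= fA; split.
  move=> [[Ax]|[s Bs <-]]; last by right; rewrite leq_addl addnK.
  by rewrite ltnS leq_eqVlt => /orP[/eqP xf|]; [rewrite xf in Ax|left].
move=> [[lt_x Ax]|[le_x Bx]]; first by left; split=> //; exact: ltnW.
by right; exists (x - f) => //; rewrite subnK.
Qed.

Lemma conjoint_sumE {A B : set nat} {f : nat} :
  Frobenius A = f -> ~ A f ->
  forall x, (A ⊞C B) x <-> x < f /\ A x \/ f < x /\ B (x - f).
Proof.
move=> fA Af x; rewrite /conjoint_sum /conductor subn1 /= fA; split.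
  move=> [[Ax]|[s [Bs s0] <-]]; last by right; rewrite addnK; split=> //; lia.
  by rewrite ltnS leq_eqVlt => /orP[/eqP xf|]; [rewrite xf in Ax|left].
move=> [[lt_x Ax]|[lt_x Bx]]; first by left; split=> //; exact: ltnW.
right; exists (x - f); last by rewrite subnK // ltnW.
by split=> //; lia.
Qed.

Definition is_decomposition (S : set nat) (t : nat) (R : set nat) : Prop :=
  R = S ⊞C ordinary t.+1 ⊞B dual S \/ R = S ⊞B ordinary t.+1 ⊞C dual S.

Lemma conjoint_bonded_dualE {S : set nat} {t : nat} :
  proper_numerical_set S -> 0 < t -> let f := Frobenius S in
  forall x, (S ⊞C ordinary t.+1 ⊞B dual S) x <->
  x < f /\ S x \/ f + t <= x /\ (x <= f + f + t -> ~ S (f + f + t - x)).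
Proof.
move=> pS t_gt0 f x; have [Sf S_gt] := Frobenius_spec pS.
have TE := conjoint_sumE (B := ordinary t.+1) (erefl f) Sf.
have Tft : ~ (S ⊞C ordinary t.+1) (f + t) by rewrite TE /ordinary /=; lia.
have FT : Frobenius (S ⊞C ordinary t.+1) = f + t.
  by apply: Frobenius_unique => // y; rewrite TE /ordinary /=; lia.
rewrite (bonded_sumE FT Tft) TE (dualE pS) -/f /ordinary /=.
have -> : (x - (f + t) <= f) = (x <= f + f + t) by lia.
have [lt_x|le_x] := ltnP x (f + t); first by intuition lia.
have -> : f - (x - (f + t)) = f + f + t - x by lia.
by intuition lia.
Qed.

Lemma bonded_conjoint_dualE {S : set nat} {t : nat} :
  proper_numerical_set S -> 0 < t -> let f := Frobenius S in
  forall x, (S ⊞B ordinary t.+1 ⊞C dual S) x <->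
  x < f /\ S x \/ x = f \/
  f + t < x /\ (x <= f + f + t -> ~ S (f + f + t - x)).
Proof.
move=> pS t_gt0 f x; have [Sf S_gt] := Frobenius_spec pS.
have TE := bonded_sumE (B := ordinary t.+1) (erefl f) Sf.
have Tft : ~ (S ⊞B ordinary t.+1) (f + t) by rewrite TE /ordinary /=; lia.
have FT : Frobenius (S ⊞B ordinary t.+1) = f + t.
  by apply: Frobenius_unique => // y; rewrite TE /ordinary /=; lia.
rewrite (conjoint_sumE FT Tft) TE (dualE pS) -/f /ordinary /=.
have -> : (x - (f + t) <= f) = (x <= f + f + t) by lia.
have -> : (f <= x /\ (x - f = 0 \/ t < x - f)) <-> (x = f \/ f + t < x) by lia.
have [lt_x|le_x] := ltnP x (f + t).
  by intuition lia.
have -> : f - (x - (f + t)) = f + f + t - x by lia.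
by intuition lia.
Qed.

Lemma Frobenius_decomposition {R S : set nat} {t : nat} :
  proper_numerical_set S -> 0 < t -> is_decomposition S t R ->
  Frobenius R = Frobenius S + Frobenius S + t.
Proof.
move=> pS t_gt0; have [[[S0 _] _] [Sf S_gt]] := (pS, Frobenius_spec pS).
move=> SR; apply: Frobenius_unique => [|x lt_x].
  case: SR => ->; rewrite ?(conjoint_bonded_dualE pS) ?(bonded_conjoint_dualE pS) //.
    by rewrite leqnn subnn => -[|[_ /(_ isT)]//]; lia.
  by rewrite leqnn subnn => -[|[|[_ /(_ isT)]//]]; lia.
case: SR => ->; rewrite ?(conjoint_bonded_dualE pS) ?(bonded_conjoint_dualE pS) //.
  by right; lia.
by right; right; lia.
Qed.

(** * The summand *)

(** The only candidate for S: below its Frobenius number S agrees with R. *)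
Definition truncation (R : set nat) (f : nat) : set nat :=
  [set x | x < f /\ R x \/ f < x].

Lemma Frobenius_truncation {R f} : Frobenius (truncation R f) = f.
Proof. by apply: Frobenius_unique => [|x lt_fx]; rewrite /truncation /=; lia. Qed.

Lemma truncation_proper {R : set nat} {f : nat} :
  0 < f -> R 0 -> proper_numerical_set (truncation R f).
Proof.
move=> f_gt0 R0; split; first split; first by left.
  apply: (sub_finite_set _ (finite_II f.+1)) => x /=; rewrite ltnS => Tx.
  by rewrite leqNgt; apply/negP => lt_fx; apply: Tx; right.
move=> TT; have : truncation R f f by rewrite TT.
by rewrite /truncation /=; lia.
Qed.

(** Uniqueness: R determines F(S) through F(R) = 2 F(S) + t, and the elements of S
below F(S) since both sums begin with them. *)
Lemma decomposition_truncation {R S : set nat} {t f : nat} :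
  proper_numerical_set S -> 0 < t -> is_decomposition S t R ->
  Frobenius R = f + f + t -> S = truncation R f.
Proof.
move=> pS t_gt0 SR; rewrite (Frobenius_decomposition pS t_gt0 SR) => ff.
have {}ff : Frobenius S = f by lia.
have [Sf S_gt] := Frobenius_spec pS; rewrite ff in Sf S_gt.
have RS x : x < f -> R x <-> S x.
  by move=> lt_xf; case: SR => ->;
    rewrite ?(conjoint_bonded_dualE pS t_gt0) ?(bonded_conjoint_dualE pS t_gt0) ff;
    intuition lia.
apply/seteqP; split=> x; rewrite /truncation /=.
  move=> Sx; have [lt_xf|lt_fx|xf] := ltngtP x f; [left|by right|].
    by rewrite RS.
  by rewrite xf in Sx.
by move=> [[lt_xf Rx]|/S_gt//]; rewrite -RS.
Qed.

(** Existence. The mirror gaps are the t - 1 integers between f and f + t, and F(R).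
Elsewhere R is the complement of its mirror image, so R contains exactly one of f
and f + t, which selects the sum to use. *)
Lemma truncation_decomposition {R : set nat} {t f : nat} :
  numerical_semigroup R -> 0 < f -> 0 < t -> proper_numerical_set R ->
  Frobenius R = f + f + t ->
  mirror_gaps R = [set x | f < x < f + t \/ x = f + f + t] ->
  is_decomposition (truncation R f) t R.
Proof.
move=> sR f_gt0 t_gt0 pR FR mirrorE; have [[R0 _] _] := sR.
have [RF R_gt] := Frobenius_spec pR; rewrite FR in RF R_gt.
have pT := truncation_proper f_gt0 R0.
have Tf := Frobenius_truncation (R := R) (f := f).
have gap x : f < x < f + t -> ~ R x.
  by move=> x_in; have [] : mirror_gaps R x by rewrite mirrorE; left.
have mirror x : x <= f + f + t -> ~ (f < x < f + t) ->
    R x <-> ~ R (f + f + t - x).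
  rewrite -FR => le_x x_out; have [->|xF] := eqVneq x (Frobenius R).
    by rewrite subnn FR; tauto.
  by apply: mirror_complement => //; rewrite mirrorE /= -FR => -[|/eqP]; [|exact/negP].
have T_lt x : x < f -> truncation R f x <-> R x.
  by rewrite /truncation /= => lt_xf; intuition lia.
have T_f : ~ truncation R f f by rewrite /truncation /=; lia.
(* Both sums at once: they differ in the two middle cases only. *)
suff RE x : R x <-> x < f /\ R x \/ x = f /\ R f \/ x = f + t /\ ~ R f \/
    f + t < x /\ (x <= f + f + t -> ~ R (f + f + t - x)).
  have RE' x : R x <-> x < f /\ truncation R f x \/ x = f /\ R f \/
      x = f + t /\ ~ R f \/
      f + t < x /\ (x <= f + f + t -> ~ truncation R f (f + f + t - x)).
    rewrite RE; have [lt_x|le_x] := ltnP x f.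
      by rewrite T_lt //; intuition lia.
    have [lt_x|{}le_x] := ltnP (f + t) x; last by intuition lia.
    have [x_le|x_gt] := leqP x (f + f + t); last by intuition lia.
    by rewrite (T_lt (f + f + t - x)); intuition lia.
  have T_ft : ~ truncation R f (f + f + t - (f + t)).
    by have -> : f + f + t - (f + t) = f by lia.
  have [Rf|Rf] := pselect (R f); [right|left]; apply/seteqP; split=> x;
    rewrite ?(conjoint_bonded_dualE pT t_gt0) ?(bonded_conjoint_dualE pT t_gt0) Tf RE'.
  - by intuition lia.
  - by intuition lia.
  - by have [->|] := eqVneq x (f + t); intuition lia.
  - by have [->|] := eqVneq x (f + t); intuition lia.
have [lt_x|lt_x|xf] := ltngtP x f.
- by intuition lia.
- have [lt_xft|lt_xft|xft] := ltngtP x (f + t).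
  + by have Rx : ~ R x by [apply: gap; lia]; intuition lia.
  + have [le_x|gt_x] := leqP x (f + f + t).
      by rewrite {1}mirror //; intuition lia.
    by have := R_gt x gt_x; intuition lia.
  + rewrite {1}mirror; [|lia|lia].
    have -> : f + f + t - x = f by lia.
    by intuition lia.
- by rewrite xf; intuition lia.
Qed.

Theorem theorem5p8 (R : set nat) (n : nat) (r : nat -> nat)
    (t : nat) (a : nat -> int)
    (R_enum : enumerated_by R n r)
    (R_sg : numerical_semigroup R)
    (R_as : almost_symmetric R)
    (R_type : sgtype R = t)
    (t_ge2 : 2 <= t)
    (R_neq : R <> ordinary t.+1)
    (PF_enum : pseudo_Frobenius R = [set a i | i in [set i | 1 <= i <= t]])
    (a_incr : forall i j : nat, 1 <= i -> i < j <= t -> (a i < a j)%R)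
    (a_last : (a t = (Frobenius R)%:Z)%R)
    (PF_gap : exists k : nat,
       [/\ 1 <= k <= n, ((r k.-1)%:Z < a 1%N)%R & (a t.-1 < (r k)%:Z)%R])
    (PF_consec : forall i : nat, 2 <= i <= t.-1 -> (a i - a i.-1 = 1)%R) :
  exists! S : set nat, proper_numerical_set S /\
    (R = S ⊞C ordinary t.+1 ⊞B dual S \/ R = S ⊞B ordinary t.+1 ⊞C dual S).
Proof.
have t_gt0 : 0 < t by lia.
have [pR _ _ _ _] := R_enum.
have [RF R_gt] := Frobenius_spec pR.
have mirrorE x : mirror_gaps R x <-> exists2 i, 1 <= i <= t & (a i = x%:Z)%R.
  have PFE := almost_symmetric_pseudo_Frobenius pR R_sg R_as.
  split=> [mx|[i i_t ai]].
    have : pseudo_Frobenius R (Posz x) by rewrite PFE; exists x.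
    by rewrite PF_enum => -[i i_t ai]; exists i.
  have : pseudo_Frobenius R (Posz x) by rewrite PF_enum; exists i.
  by rewrite PFE => -[y my [<-]].
have a1_gt0 : (0 < a 1%N)%R by case: PF_gap => k [_]; lia.
(* The indexing from f puts the interval at f + 1, ..., f + t - 1. *)
pose f := `|a 1%N|%N.-1.
have aE i : 1 <= i < t -> (a i = (f + i)%N%:Z)%R.
  elim: i => // -[|i] IHi i_t; first by rewrite /f; lia.
  have := PF_consec i.+2; rewrite /= => /(_ ltac:(lia)).
  by have := IHi ltac:(lia); lia.
have mirrorE' x : mirror_gaps R x <-> f < x < f + t \/ x = Frobenius R.
  rewrite mirrorE; split=> [[i i_t]|[x_in|->]].
  - have [it|lt_it] : i = t \/ i < t by lia.
      by rewrite it a_last => -[<-]; right.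
    by rewrite aE; [left|]; lia.
  - by exists (x - f); [|rewrite aE]; lia.
  - by exists t; [lia|].
(* Both ends of the interval reflect into the interval, which fixes F(R). *)
have lt_F i : 1 <= i < t -> f + i < Frobenius R.
  by move=> i_t; have := a_incr i t; rewrite aE // a_last; lia.
have mirror_sym i : 1 <= i < t -> f < Frobenius R - (f + i) < f + t.
  move=> i_t; have i_F := lt_F i i_t.
  have [Ri _ RFi] : mirror_gaps R (f + i) by rewrite mirrorE'; lia.
  have : mirror_gaps R (Frobenius R - (f + i)).
    by split; [apply: RFi| |rewrite subKn]; rewrite ?leq_subr //; lia.
  by rewrite mirrorE'; lia.
have FR : Frobenius R = f + f + t.
  by have := mirror_sym 1; have := mirror_sym t.-1; lia.
(* For f = 0 the gaps are 1, ..., t. *)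
have f_gt0 : 0 < f.
  rewrite lt0n; apply/eqP => f0; apply: R_neq.
  apply/seteqP; split=> x; rewrite /ordinary /=.
    move=> Rx; have [|lt_tx] := ltnP t x; first by right.
    have [->|x0] := eqVneq x 0; first by left.
    by have [] : mirror_gaps R x; first by rewrite mirrorE' FR; lia.
  by move=> [->|lt_tx]; [case: R_sg => -[]|apply: R_gt; lia].
have [[R0 _] _] := R_sg.
exists (truncation R f); split.
  split; first exact: truncation_proper.
  apply: truncation_decomposition => //; apply/seteqP; rewrite -FR.
  by split=> x /mirrorE'.
by move=> S [pS SR]; rewrite (decomposition_truncation pS t_gt0 SR FR).
Qed.
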